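(* For all integers $n\ge 0$, $$x\sum_{l=0}^{n}{n \brace l}K_l(x)(-1)^{n-l}=\sum_{l=0}^{n}\binom{n}{l}2^l\phi_{l+1}(x)\phi_{n-l}(-x).$$
   Context: All identities are between polynomials in an indeterminate $x$ with real coefficients. For $n\ge 0$, $K_n(x)=n!\sum_{k=0}^{n}\binom{n+k+1}{n-k}\frac{x^k}{k!}$. ${n \brace k}$ denotes the Stirling numbers of the second kind, given by $\frac{1}{k!}(e^t-1)^k=\sum_{n=k}^{\infty}{n \brace k}\frac{t^n}{n!}$. The Bell polynomials are $\phi_n(x)=\sum_{k=0}^{n}{n \brace k}x^k$, $n\ge 0$. *)

(* Defs.v *)
From HB Require Import structures.
From mathcomp Require Import all_boot all_order all_algebra.
From mathcomp Require Import reals.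
Set Implicit Arguments.
Unset Strict Implicit.
Unset Printing Implicit Defensive.
Import Order.TTheory GRing.Theory Num.Theory.
Local Open Scope ring_scope.

(* A formal power series \sum_n f_n t^n is represented by its coefficient
   sequence f : nat -> R. *)
Section FormalPowerSeries.
Variable R : realType.
Implicit Types f g : nat -> R.

Definition fps_one : nat -> R := fun n => (n == 0%N)%:R.

Definition fps_sub f g : nat -> R := fun n => f n - g n.

Definition fps_mul f g : nat -> R :=
  fun n => \sum_(i < n.+1) f i * g (n - i)%N.

Definition fps_scale (c : R) f : nat -> R := fun n => c * f n.

Definition fps_pow f (k : nat) : nat -> R := iter k (fps_mul f) fps_one.

Definition fps_exp : nat -> R := fun n => (n`!%:R)^-1.

(* (e^t - 1)^k / k! *)
Definition stirling2_gf (k : nat) : nat -> R :=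
  fps_scale (k`!%:R)^-1 (fps_pow (fps_sub fps_exp fps_one) k).

(* n! times the coefficient of t^n, i.e. the coefficient of t^n / n!. *)
Definition stirling2 (n k : nat) : R := n`!%:R * stirling2_gf k n.

(* The series stirling2_gf k starts at t^k, so that it is equal to
   \sum_(n >= k) stirling2 n k * t^n / n!. *)
Lemma stirling2_gfE (k n : nat) :
  stirling2_gf k n = if (k <= n)%N then stirling2 n k / n`!%:R else 0.
Proof.
case: leqP => [_|].
  by rewrite /stirling2 mulrAC divff ?mul1r // pnatr_eq0 -lt0n fact_gt0.
rewrite /stirling2_gf /fps_scale => ltnk.
suff -> : fps_pow (fps_sub fps_exp fps_one) k n = 0 by rewrite mulr0.
elim: k n ltnk => // k IHk n; rewrite ltnS => lenk.
rewrite /fps_pow iterS /fps_mul big_ord_recl /= big1 => [|i _].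
  by rewrite /fps_sub /fps_exp /fps_one eqxx fact0 invr1 subrr mul0r addr0.
rewrite -/(fps_pow _ k) IHk ?mulr0 //.
by apply: leq_trans lenk; rewrite /bump /= add1n ltn_subrL (leq_ltn_trans _ (ltn_ord i)).
Qed.

End FormalPowerSeries.

Definition bell_poly (R : realType) (n : nat) : {poly R} :=
  \sum_(k < n.+1) stirling2 R n k *: 'X^k.

Definition K_poly (R : realType) (n : nat) : {poly R} :=
  n`!%:R *: \sum_(k < n.+1) (('C(n + k + 1, n - k))%N%:R / k`!%:R) *: 'X^k.

(* Main.v *)
Require Import Defs.
From HB Require Import structures.
From mathcomp Require Import all_boot all_order all_algebra.
From mathcomp Require Import reals ring zify.
Set Implicit Arguments.
Unset Strict Implicit.
Unset Printing Implicit Defensive.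
Import Order.TTheory GRing.Theory Num.Theory.
Local Open Scope ring_scope.

(** Read a sequence a as the exponential generating function
    \sum_n a_n t^n / n!.  With Phi(t) = exp(x (e^t - 1)), the series of the Bell
    polynomials, one has Phi' = x e^t Phi, so that the right-hand side of the
    theorem has the series
      Phi'(2t) exp(-x (e^t - 1)) = x e^(2t) exp(x (e^(2t) - e^t)).
    In the variable u = 1 - e^(-t) the last series without its factor x is
      (1 - u)^(-2) exp(x u / (1 - u)^2) = \sum_l K_l(x) u^l / l!,
    by the negative binomial expansion of u^k (1 - u)^(-2k-2), and
    u^l / l! = \sum_n (-1)^(n-l) S(n, l) t^n / n! turns it into the left-hand
    side.

    No substitution of series is carried out: both sides are embedded into a
    family indexed by m, with e^(mt) in place of e^(2t).  The derivative
      d/dt e^(mt) exp(x (e^(2t) - e^t))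
        = (m e^(mt) + 2x e^((m+2)t) - x e^((m+1)t)) exp(x (e^(2t) - e^t))
    gives a recurrence in n over all m, with value 1 at n = 0, which determines
    the family.  On the Bell side it is the Leibniz rule for binomial
    convolution ([bell_conv_rec]); on the K side it is the Stirling recurrence
    ([stirling2_transform_rec]) combined with a relation between binomial
    coefficients ([gen_KS]). *)

(** * Binomial convolution *)

Section BinomialConvolution.
Variable A : comNzRingType.
Implicit Types (a b c : nat -> A) (x y : A).

(** The product of exponential generating functions, for which the derivative
    d/dt is the shift of the sequence. *)
Definition bconv a b : nat -> A :=
  fun n => \sum_(l < n.+1) 'C(n, l)%:R * a l * b (n - l)%N.

Definition shift a : nat -> A := fun n => a n.+1.

Lemma eq_bconv a a' b b' : a =1 a' -> b =1 b' -> bconv a b =1 bconv a' b'.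
Proof. by move=> ea eb n; apply: eq_bigr => l _; rewrite ea eb. Qed.

Lemma bconv0 a b : bconv a b 0%N = a 0%N * b 0%N.
Proof. by rewrite /bconv big_ord1 bin0 mul1r. Qed.

(** The Leibniz rule: Pascal's rule splits every term in two. *)
Lemma bconvS a b n :
  bconv a b n.+1 = bconv (shift a) b n + bconv a (shift b) n.
Proof.
rewrite /bconv big_ord_recl /= bin0 subn0.
under eq_bigr => l _ do
  rewrite /bump add1n binS natrD subSS !mulrDl.
rewrite big_split /= addrA addrC; congr (_ + _).
rewrite big_ord_recr /= bin_small // !mul0r addr0 big_ord_recl /= bin0 subn0.
by congr (_ + _); apply: eq_bigr => l _; rewrite /shift /bump add1n subnSK.
Qed.

Lemma bconvDl a a' b n :
  bconv (fun i => a i + a' i) b n = bconv a b n + bconv a' b n.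
Proof. by rewrite -big_split; apply: eq_bigr => l _ /=; ring. Qed.

Lemma bconvZl x a b n : bconv (fun i => x * a i) b n = x * bconv a b n.
Proof. by rewrite mulr_sumr; apply: eq_bigr => l _; ring. Qed.

Lemma bconvC a b : bconv a b =1 bconv b a.
Proof.
move=> n; elim: n a b => [|n IHn] a b; first by rewrite !bconv0 mulrC.
by rewrite !bconvS IHn addrC IHn.
Qed.

Lemma bconvDr a b b' n :
  bconv a (fun i => b i + b' i) n = bconv a b n + bconv a b' n.
Proof. by rewrite bconvC bconvDl !(bconvC a). Qed.

Lemma bconvZr x a b n : bconv a (fun i => x * b i) n = x * bconv a b n.
Proof. by rewrite bconvC bconvZl bconvC. Qed.

(** Both sides agree at 0 and have the same Leibniz expansion, so induction on
    the index replaces any manipulation of double sums. *)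
Lemma bconvA a b c : bconv a (bconv b c) =1 bconv (bconv a b) c.
Proof.
move=> n; elim: n a b c => [|n IHn] a b c; first by rewrite !bconv0 mulrA.
have shiftM u v : shift (bconv u v)
    =1 fun i => bconv (shift u) v i + bconv u (shift v) i by move=> i; apply: bconvS.
rewrite !bconvS (eq_bconv (frefl _) (shiftM _ _)).
by rewrite (eq_bconv (shiftM _ _) (frefl _)) bconvDl bconvDr !IHn addrA.
Qed.

Lemma bconvCA a b c : bconv a (bconv b c) =1 bconv b (bconv a c).
Proof.
move=> n; rewrite !bconvA.
exact: (eq_bconv (bconvC a b) (frefl c)).
Qed.

Lemma bconv_exprn x y : bconv (GRing.exp x) (GRing.exp y) =1 GRing.exp (x + y).
Proof.
move=> n; rewrite addrC exprDn; apply: eq_bigr => l _.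
by rewrite -mulr_natl; ring.
Qed.

Lemma bconv_dilate x a b n :
  bconv (fun i => x ^+ i * a i) (fun i => x ^+ i * b i) n = x ^+ n * bconv a b n.
Proof.
rewrite mulr_sumr; apply: eq_bigr => -[l /=]; rewrite ltnS => len _.
have -> : x ^+ n = x ^+ l * x ^+ (n - l) by rewrite -exprD subnKC.
by ring.
Qed.

End BinomialConvolution.

(** * Stirling numbers *)

Section Stirling.
Variable R : realType.

Lemma stirling2_small n k : (n < k)%N -> stirling2 R n k = 0.
Proof. by move=> lt; rewrite /stirling2 stirling2_gfE leqNgt lt mulr0. Qed.

Lemma stirling2n0 n : stirling2 R n 0 = (n == 0%N)%:R.
Proof.
rewrite /stirling2 /stirling2_gf /fps_scale /= /fps_one fact0 invr1 mul1r.
by case: n => [|n]; rewrite ?mulr0 // fact0 mul1r.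
Qed.

Let E n : R := (n != 0%N)%:R.

(** (e^t - 1)^(k+1) / k! is the product of e^t - 1 and (e^t - 1)^k / k!. *)
Lemma stirling2_bconv n k :
  k.+1%:R * stirling2 R n k.+1 = bconv E (fun i => stirling2 R i k) n.
Proof.
have nf m : m`!%:R != 0 :> R by rewrite pnatr_eq0 -lt0n fact_gt0.
have n1 : k.+1%:R != 0 :> R by rewrite pnatr_eq0.
rewrite /stirling2 /stirling2_gf /fps_scale /fps_pow iterS -/(fps_pow _ k).
rewrite {1}/fps_mul /bconv !mulr_sumr; apply: eq_bigr => -[l /=].
rewrite ltnS => len _.
rewrite -(bin_fact len) factS !natrM.
have -> : fps_sub (fps_exp R) (fps_one R) l = E l / l`!%:R.
  rewrite /fps_sub /fps_exp /fps_one /E; case: eqP => [->|_] /=.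
    by rewrite fact0 invr1 subrr mul0r.
  by rewrite subr0 mul1r.
by field; rewrite !nf addrC natr1 n1.
Qed.

(** The derivative of (e^t - 1)^(k+1) / (k+1)! is e^t (e^t - 1)^k / k!. *)
Lemma stirling2SS_bconv n k :
  stirling2 R n.+1 k.+1 = bconv (GRing.exp 1) (fun i => stirling2 R i k) n.
Proof.
have ES : shift E =1 GRing.exp 1 by move=> i; rewrite expr1n.
have nz i : i.+1%:R != 0 :> R by rewrite pnatr_eq0.
elim: k n => [|k IHk] n.
  apply: (mulfI (nz 0%N)).
  rewrite stirling2_bconv bconvS (eq_bconv ES (frefl _)) mul1r.
  rewrite [X in _ + X]big1 ?addr0 // => l _.
  by rewrite /shift stirling2n0 mulr0.
apply: (mulfI (nz k.+1)).
rewrite stirling2_bconv bconvS (eq_bconv ES (frefl _)).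
rewrite (eq_bconv (frefl E) (b' := bconv (GRing.exp 1) (stirling2 R ^~ k))) //.
rewrite bconvCA.
have E_st : bconv E (stirling2 R ^~ k) =1 fun i => k.+1%:R * stirling2 R i k.+1.
  by move=> i; rewrite stirling2_bconv.
rewrite (eq_bconv (frefl _) E_st) bconvZr.
by rewrite -[k.+2]addn1 natrD mulrDl mul1r addrC.
Qed.

(** Write e^t = 1 + (e^t - 1) in the derivative above. *)
Lemma stirling2SS n k :
  stirling2 R n.+1 k.+1 = stirling2 R n k + k.+1%:R * stirling2 R n k.+1.
Proof.
rewrite stirling2SS_bconv stirling2_bconv.
have eE : GRing.exp 1 =1 fun i => (i == 0%N)%:R + E i :> R.
  by case=> [|i]; rewrite expr1n /E /= ?addr0 ?add0r.
rewrite (eq_bconv eE (frefl _)) bconvDl; congr (_ + _).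
rewrite /bconv big_ord_recl /= bin0 subn0 !mul1r big1 ?addr0 // => l _.
by rewrite mulr0 mul0r.
Qed.

(** Since t |-> u = 1 - e^(-t) satisfies du/dt = 1 - u, the derivative in t of
    \sum_l f_l u^l / l! is obtained by replacing f_l with f_(l+1) - l f_l. *)
Lemma stirling2_transform_rec (V : lalgType R) (f : nat -> V) n :
  \sum_(l < n.+2) (stirling2 R n.+1 l *: f l) * (-1) ^+ (n.+1 - l)
  = \sum_(l < n.+1)
      (stirling2 R n l *: (f l.+1 - l%:R *: f l)) * (-1) ^+ (n - l).
Proof.
rewrite big_ord_recl stirling2n0 scale0r mul0r add0r.
under eq_bigr => l _ do rewrite /= /bump add1n subSS stirling2SS scalerDl mulrDl.
under [RHS]eq_bigr => l _ do rewrite scalerBr mulrBl scalerA.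
rewrite big_split sumrB /=; congr (_ + _).
rewrite big_ord_recr /= stirling2_small // mulr0 scale0r mul0r addr0.
rewrite [X in _ = - X]big_ord_recl /= mulr0 scale0r mul0r add0r -sumrN.
apply: eq_bigr => l _; rewrite /bump add1n [_.+1%:R * _]mulrC.
by rewrite -(subnSK (ltn_ord l)) exprS mulN1r mulrN.
Qed.

End Stirling.

(** * Bell polynomials *)

Section Bell.
Variable R : realType.

(** Phi' = x e^t Phi. *)
Lemma bell_polyS n : bell_poly R n.+1 = 'X * bconv (GRing.exp 1) (bell_poly R) n.
Proof.
rewrite /bell_poly big_ord_recl stirling2n0 scale0r add0r mulr_sumr.
under [LHS]eq_bigr => k _.
  rewrite /= /bump add1n stirling2SS_bconv scaler_suml exprS.
over.
rewrite exchange_big; apply: eq_bigr => l _ /=.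
have -> : \sum_(k < (n - l).+1) stirling2 R (n - l) k *: 'X^k
        = \sum_(k < n.+1) stirling2 R (n - l) k *: 'X^k :> {poly R}.
  rewrite (big_ord_widen n.+1 (fun k => stirling2 R (n - l) k *: 'X^k)).
    rewrite [RHS](bigID (fun k : 'I__ => (k < (n - l).+1)%N)) /=.
    rewrite [X in _ = _ + X]big1 ?addr0 // => k; rewrite -leqNgt => lk.
    by rewrite stirling2_small ?scale0r.
  by rewrite ltnS leq_subr.
rewrite !mulr_sumr; apply: eq_bigr => k _.
rewrite !expr1n !mulr1 -!mul_polyC polyCM rmorph_nat; ring.
Qed.

Let a n : {poly R} := 2 ^+ n * bell_poly R n.
Let b n : {poly R} := bell_poly R n \Po (- 'X).

Let shift_a : shift a =1 fun n => 2 * 'X * bconv (GRing.exp 2) a n.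
Proof.
move=> n; rewrite /shift {1}/a bell_polyS exprS.
have e2 : GRing.exp 2 =1 fun i => 2 ^+ i * 1 ^+ i :> {poly R}.
  by move=> i; rewrite expr1n mulr1.
by rewrite (eq_bconv e2 (frefl a)) bconv_dilate; ring.
Qed.

Let shift_b : shift b =1 fun n => - 'X * bconv (GRing.exp 1) b n.
Proof.
move=> n; rewrite /shift /b bell_polyS rmorphM /= comp_polyX; congr (_ * _).
rewrite /bconv rmorph_sum; apply: eq_bigr => l _.
by rewrite /= !rmorphM /= rmorph_nat !expr1n rmorph1.
Qed.

(** The coefficients of e^(mt) exp(x (e^(2t) - 1)) exp(-x (e^t - 1)); keeping
    the three factors apart makes the recurrence a direct application of the
    Leibniz rule to the differential equation of each factor. *)
Definition bell_conv (m : nat) : nat -> {poly R} :=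
  bconv (GRing.exp m%:R) (bconv a b).

Lemma bell_conv0 m : bell_conv m 0%N = 1.
Proof.
have b0 : bell_poly R 0 = 1 by rewrite /bell_poly big_ord1 stirling2n0 scale1r.
by rewrite /bell_conv !bconv0 /a /b b0 rmorph1 !mul1r.
Qed.

Lemma bell_conv_rec m n :
  bell_conv m n.+1
  = m%:R * bell_conv m n + 2 * 'X * bell_conv m.+2 n - 'X * bell_conv m.+1 n.
Proof.
have mulE k : bconv (GRing.exp m%:R) (bconv (GRing.exp k%:R) (bconv a b))
    =1 bell_conv (k + m).
  move=> i; rewrite bconvA; apply: eq_bconv => // j.
  by rewrite bconv_exprn -natrD addnC.
have shift_ab : shift (bconv a b) =1 fun i =>
    2 * 'X * bconv (GRing.exp 2%:R) (bconv a b) i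
    + - 'X * bconv (GRing.exp 1%:R) (bconv a b) i.
  move=> i; rewrite /shift bconvS (eq_bconv shift_a (frefl b)).
  rewrite (eq_bconv (frefl a) shift_b) bconvZl bconvZr bconvCA.
  by rewrite [in RHS]bconvA.
have shift_exp : shift (GRing.exp m%:R) =1 fun i => m%:R * m%:R ^+ i :> {poly R}.
  by move=> i; rewrite /shift exprS.
rewrite {1}/bell_conv bconvS (eq_bconv shift_exp (frefl _)).
rewrite (eq_bconv (frefl _) shift_ab) bconvZl bconvDr !bconvZr !mulE.
by rewrite mulNr addrA.
Qed.

Lemma bell_conv2 n :
  'X * bell_conv 2 n
  = \sum_(l < n.+1)
      ('C(n, l)%:R * 2 ^+ l) * bell_poly R l.+1 * (bell_poly R (n - l) \Po (- 'X)).
Proof.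
rewrite /bell_conv bconvA -bconvZl; apply: eq_bigr => l _.
congr (_ * _); rewrite -mulrA; congr (_ * _).
have h := shift_a l; rewrite /shift /a exprS in h.
by apply: (@mulfI _ 2); [rewrite -polyC_natr polyC_eq0 pnatr_eq0 | rewrite !mulrA h].
Qed.

End Bell.

(** * The polynomials K *)

Section KPoly.
Variable R : realType.

(** The coefficients of (1 - u)^(-m-1) exp(x u / (1 - u)^2) in u^l / l!, where
    (1 - u)^(-m-1) = e^((m+1)t): the polynomials K are the case m = 1, and the
    index is one less than that of [bell_conv] so that no predecessor occurs. *)
Definition gen_K (m l : nat) : {poly R} :=
  l`!%:R *: \sum_(k < l.+1) ('C(l + k + m, l - k)%:R / k`!%:R) *: 'X^k.

Lemma coef_gen_K m l k :
  (gen_K m l)`_k = l`!%:R * (('C(l + k + m, l - k) * (k <= l))%:R / k`!%:R).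
Proof.
rewrite /gen_K -(poly_def l.+1 (fun k => 'C(l + k + m, l - k)%:R / k`!%:R)).
by rewrite coefZ coef_poly ltnS; case: leqP; rewrite ?muln1 ?muln0 ?mul0r.
Qed.

(** After the cancellation of factorials, the coefficient of x^k is a
    consequence of Pascal's rule and of the absorption rule
    (d+1) C(N+1, d+1) = (N+1) C(N, d), where N = l + k + m and d = l - k; the
    top coefficient k = l + 1 is treated apart. *)
Lemma gen_KS m l :
  gen_K m l.+1 - l%:R *: gen_K m l
  = m.+1%:R * gen_K m l + 2 * 'X * gen_K m.+2 l - 'X * gen_K m.+1 l.
Proof.
have nf i : i`!%:R != 0 :> R by rewrite pnatr_eq0 -lt0n fact_gt0.
have -> : m.+1%:R * gen_K m l + 2 * 'X * gen_K m.+2 l - 'X * gen_K m.+1 l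
        = m.+1%:R *: gen_K m l + (2 : R) *: ('X * gen_K m.+2 l) - 'X * gen_K m.+1 l.
  by rewrite -!mul_polyC !rmorph_nat mulrA.
apply/polyP => -[|k].
  rewrite !(coef_gen_K, coefD, coefN, coefXM, coefZ) /= !addn0 !subn0 !muln1.
  rewrite fact0 invr1 factS natrM.
  have absorb : (l.+1 + m)%:R * 'C(l + m, l)%:R
      = l.+1%:R * 'C(l.+1 + m, l.+1)%:R :> R by rewrite -!natrM mul_bin_diag.
  rewrite mulr0 addr0 subr0.
  have -> : l.+1%:R * l`!%:R * ('C(l.+1 + m, l.+1)%:R * 1)
     = l`!%:R * (l.+1%:R * 'C(l.+1 + m, l.+1)%:R) :> R by ring.
  by rewrite -absorb addSn -addnS natrD; ring.
rewrite !(coef_gen_K, coefD, coefN, coefXM, coefZ) /= !ltnS.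
case: (ltngtP k l) => [ltkl|ltlk|->].
- rewrite !muln1 subSS.
  have [d ld] : exists d, l = (k + d).+1.
    by exists (l - k.+1)%N; rewrite -addSn subnKC.
  have -> : (l - k = d.+1)%N by lia.
  have -> : (l - k.+1 = d)%N by lia.
  set N := (l + k.+1 + m)%N.
  have -> : (l.+1 + k.+1 + m = N.+1)%N by rewrite /N; lia.
  have -> : (l + k + m.+2 = N.+1)%N by rewrite /N; lia.
  have -> : (l + k + m.+1 = N)%N by rewrite /N; lia.
  have absorb : N.+1%:R * 'C(N, d)%:R = d.+1%:R * 'C(N.+1, d.+1)%:R :> R.
    by rewrite -!natrM mul_bin_diag.
  have pascal : 'C(N.+1, d.+1)%:R = 'C(N, d.+1)%:R + 'C(N, d)%:R :> R.
    by rewrite -natrD binS.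
  have NE : N.+1%:R = d.+1%:R + 2 * k.+1%:R + m%:R :> R.
    by rewrite -natrM -!natrD; congr _%:R; rewrite /N; lia.
  have lE : l%:R = d.+1%:R + k%:R :> R by rewrite -natrD; congr _%:R; lia.
  have key : l.+1%:R * 'C(N.+1, d.+1)%:R - l%:R * 'C(N, d)%:R
      = m.+1%:R * 'C(N, d)%:R
        + k.+1%:R * (2 * 'C(N.+1, d.+1)%:R - 'C(N, d.+1)%:R) :> R.
    (* The difference of the two sides is that of the absorption rule. *)
    apply/eqP; rewrite -subr_eq0; apply/eqP.
    rewrite pascal in absorb *.
    rewrite -[RHS](subrr (N.+1%:R * 'C(N, d)%:R)) {1}absorb NE.
    by rewrite -![_.+1%:R]natr1 lE -natr1; ring.
  have n1 : k.+1%:R != 0 :> R by rewrite pnatr_eq0.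
  rewrite !factS !natrM.
  transitivity (l`!%:R / (k.+1%:R * k`!%:R : R)
      * (l.+1%:R * 'C(N.+1, d.+1)%:R - l%:R * 'C(N, d)%:R)).
    by field; rewrite nf addrC natr1 n1.
  by rewrite key; field; rewrite nf addrC natr1 n1.
- by rewrite !muln0 !mul0r !mulr0 !(addr0, subr0).
- by rewrite !muln0 !subnn !bin0 !mul0r !mulr0 subr0 add0r !mul1r !divff //; ring.
Qed.

Lemma gen_K0 m : gen_K m 0 = 1.
Proof. by rewrite /gen_K big_ord1 bin0 fact0 invr1 mulr1 !scale1r. Qed.

(** The recurrence determines the whole family from its values at n = 0. *)
Lemma gen_K_bell_conv m n :
  \sum_(l < n.+1) (stirling2 R n l *: gen_K m l) * (-1) ^+ (n - l)
  = bell_conv R m.+1 n.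
Proof.
elim: n m => [|n IHn] m.
  by rewrite big_ord1 gen_K0 stirling2n0 scale1r mul1r bell_conv0.
rewrite stirling2_transform_rec bell_conv_rec -!IHn !mulr_sumr -big_split /=.
rewrite -sumrB; apply: eq_bigr => l _; rewrite gen_KS -!mul_polyC; ring.
Qed.

End KPoly.

Theorem theorem3p4 (R : realType) (n : nat) :
  'X * \sum_(l < n.+1) (stirling2 R n l *: K_poly R l) * (-1) ^+ (n - l)
  = \sum_(l < n.+1)
      ('C(n, l)%:R * 2 ^+ l) * bell_poly R l.+1 * (bell_poly R (n - l) \Po (- 'X)).
Proof. by rewrite -bell_conv2 -(gen_K_bell_conv R 1). Qed.
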